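(* Let $\Phi$ be a complete simplification phase, let $\Xi;\cdot\vdash v:A$ be a well-typed closed value (empty typing context), and suppose $\Phi(\Xi,\mathtt{fp}(A))=(\Xi',\sigma)$. Then for every instantiation $\vdash\eta:\Xi\Rightarrow\Xi_{\mathrm{use}}$ there exist an instantiation $\vdash\eta':\Xi'\Rightarrow\Xi_{\mathrm{use}}$ and a value coercion $\gamma_v$ with $\Xi_{\mathrm{use}}\vdash\gamma_v:\eta'(\sigma(A))\le\eta(A)$ such that $$[\![\Xi_{\mathrm{use}};\cdot\vdash\eta(v):\eta(A)]\!]_\xi=[\![\Xi_{\mathrm{use}};\cdot\vdash(\eta'(\sigma(v))\vartriangleright\gamma_v):\eta(A)]\!]_\xi$$ for every assignment $\xi\in[\![\Xi_{\mathrm{use}}]\!]$.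
   Context: SYNTAX. Fix a global signature $\Sigma$: a finite set of operations $op$, each with two value types $A_{op},B_{op}$ (written $op:A_{op}\to B_{op}$) that contain no parameters, with $B_{op}$ not a function type. There are parameters of five kinds: skeleton $\varsigma$, dirt $\delta$, type $\alpha$, dirt coercion $\varpi$, type coercion $\omega$. Skeletons: $S::=\varsigma\mid\mathtt{Unit}\mid S_1\to S_2$. Dirts: $\Delta::=\delta\mid\emptyset\mid\{op\}\cup\Delta$, considered up to reordering and repetition of operations, so each dirt is $O$ or $O\cup\delta$ with $O$ a finite set of operations. Value types: $A::=\alpha\mid\mathtt{Unit}\mid A\to C$; computation types: $C::=A\,!\,\Delta$. A (parameter) context $\Xi$ is a finite list of distinct parameters: $\varsigma$; $\delta$; $\alpha:S$; $\varpi:\Delta_1\le\Delta_2$; $\omega:A_1\le A_2$. $\Xi\vdash S\ \mathtt{skel}$ (resp. $\Xi\vdash\Delta\ \mathtt{dirt}$) means all parameters of $S$ (resp. $\Delta$) are in $\Xi$ and all operations in $\Delta$ are in $\Sigma$. $\Xi\vdash A:S$ and $\Xi\vdash C:S$ (with $\Xi\vdash S\ \mathtt{skel}$) are given by: $\alpha:S$ if $(\alpha:S)\in\Xi$; $\mathtt{Unit}:\mathtt{Unit}$; $A\to C:S_1\to S_2$ if $A:S_1$, $C:S_2$; $A\,!\,\Delta:S$ if $A:S$ and $\Xi\vdash\Delta\ \mathtt{dirt}$. $\Xi$ is well-formed if all skeletons and dirts occurring in it are well-formed in $\Xi$ and for each $\omega:A_1\le A_2$ in $\Xi$ both $A_i$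 have a common skeleton in $\Xi$. All contexts are assumed well-formed. COERCIONS. Dirt coercions $\gamma_d::=\varpi\mid\gamma_d^2\circ\gamma_d^1\mid\langle\delta\rangle\mid\langle\emptyset\rangle\mid\emptyset_\delta\mid\{op\}\cup\gamma_d\mid\{op\}\cup^+\gamma_d$; value coercions $\gamma_v::=\omega\mid\gamma_v^2\circ\gamma_v^1\mid\langle\alpha\rangle\mid\langle\mathtt{Unit}\rangle\mid\gamma_v\to\gamma_c$; computation coercions $\gamma_c::=\gamma_v\,!\,\gamma_d$. Rules in context $\Xi$ (both sides are presupposed well-formed, and for types of the same skeleton): $\varpi,\omega$ have the inequality declared in $\Xi$; $\gamma^2\circ\gamma^1:X\le Z$ if $\gamma^1:X\le Y$, $\gamma^2:Y\le Z$; $\langle\delta\rangle:\delta\le\delta$; $\langle\emptyset\rangle:\emptyset\le\emptyset$; $\emptyset_\delta:\emptyset\le\delta$; if $\gamma_d:\Delta\le\Delta'$ then $\{op\}\cup\gamma_d:\{op\}\cup\Delta\le\{op\}\cup\Delta'$ and $\{op\}\cup^+\gamma_d:\Delta\le\{op\}\cup\Delta'$; $\langle\alpha\rangle:\alpha\le\alpha$; $\langle\mathtt{Unit}\rangle:\mathtt{Unit}\le\mathtt{Unit}$; $\gamma_v\to\gamma_c:(A\to C)\le(A'\to C')$ if $\gamma_v:A'\le A$, $\gamma_c:C\le C'$; $\gamma_v\,!\,\gamma_d:(A\,!\,\Delta)\le(A'\,!\,\Delta')$ if $\gamma_v:A\le A'$, $\gamma_d:\Delta\le\Delta'$. For arbitrary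 dirts and types define $\emptyset_\emptyset=\langle\emptyset\rangle$, $\emptyset_{\{op\}\cup\Delta}=\{op\}\cup^+\emptyset_\Delta$, $\langle\{op\}\cup\Delta\rangle=\{op\}\cup\langle\Delta\rangle$, $\langle A\to C\rangle=\langle A\rangle\to\langle C\rangle$, $\langle A\,!\,\Delta\rangle=\langle A\rangle\,!\,\langle\Delta\rangle$. TERMS. Typing contexts $\Gamma=x_1:A_1,\dots,x_n:A_n$ (well-formed in $\Xi$ if each $A_i$ is). Values $v::=x\mid\mathtt{unit}\mid\mathtt{fun}\,(x:A)\mapsto c\mid v\vartriangleright\gamma_v$; computations $c::=\mathtt{return}\,v\mid op\,v\,(y:A.\,c)\mid\mathtt{do}\,x\leftarrow c_1;c_2\mid v_1\,v_2\mid c\vartriangleright\gamma_c$. Typing $\Xi;\Gamma\vdash v:A$, $\Xi;\Gamma\vdash c:C$: variables have their type in $\Gamma$; $\mathtt{unit}:\mathtt{Unit}$; $\mathtt{fun}\,(x:A)\mapsto c:A\to C$ if $c:C$ in $\Gamma,x:A$; $v\vartriangleright\gamma_v:A'$ if $v:A$, $\gamma_v:A\le A'$; $\mathtt{return}\,v:A\,!\,\emptyset$ if $v:A$; $\mathtt{do}\,x\leftarrow c_1;c_2:A'\,!\,\Delta$ if $c_1:A\,!\,\Delta$ and $c_2:A'\,!\,\Delta$ in $\Gamma,x:A$; $v_1\,v_2:C$ if $v_1:A\to C$, $v_2:A$; $op\,v\,(y:B_{op}.\,c):A\,!\,\Delta$ if $op\in\Sigma$, $v:A_{op}$, $c:A\,!\,\Delta$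 in $\Gamma,y:B_{op}$, and $op\in\Delta$; $c\vartriangleright\gamma_c:C'$ if $c:C$, $\gamma_c:C\le C'$. SUBSTITUTIONS. A valid substitution $\vdash\sigma:\Xi\Rightarrow\Xi'$ assigns to every parameter of $\Xi$: to $\varsigma$ a skeleton with $\Xi'\vdash\sigma(\varsigma)\ \mathtt{skel}$; to $\delta$ a dirt with $\Xi'\vdash\sigma(\delta)\ \mathtt{dirt}$; to $\alpha:S$ a value type with $\Xi'\vdash\sigma(\alpha):\sigma(S)$; to $\varpi:\Delta_1\le\Delta_2$ a coercion $\Xi'\vdash\sigma(\varpi):\sigma(\Delta_1)\le\sigma(\Delta_2)$; to $\omega:A_1\le A_2$ a coercion $\Xi'\vdash\sigma(\omega):\sigma(A_1)\le\sigma(A_2)$. It acts homomorphically on skeletons, dirts, types, coercions (with $\sigma(\langle\delta\rangle)=\langle\sigma(\delta)\rangle$, $\sigma(\langle\alpha\rangle)=\langle\sigma(\alpha)\rangle$, $\sigma(\emptyset_\delta)=\emptyset_{\sigma(\delta)}$), typing contexts and terms. Composition: $(\sigma'\circ\sigma)(p)=\sigma'(\sigma(p))$ for each parameter $p$. POLARITY. Free parameters are pairs of sets $F=(F^+,F^-)$ of type and dirt parameters; set operations are componentwise and $\overline{(F^+,F^-)}=(F^-,F^+)$. $\mathtt{fp}(\alpha)=(\{\alpha\},\emptyset)$, $\mathtt{fp}(\delta)=(\{\delta\},\emptyset)$, $\mathtt{fp}(\mathtt{Unit})=\mathtt{fp}(\emptyset)=(\emptyset,\emptyset)$, $\mathtt{fp}(A\to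 C)=\overline{\mathtt{fp}(A)}\cup\mathtt{fp}(C)$, $\mathtt{fp}(\{op\}\cup\Delta)=\mathtt{fp}(\Delta)$, $\mathtt{fp}(A\,!\,\Delta)=\mathtt{fp}(A)\cup\mathtt{fp}(\Delta)$. COERCION FAMILIES. A coercion family $Y$ assigns a value coercion $Y(\alpha)$ to each type parameter and a dirt coercion $Y(\delta)$ to each dirt parameter. For $\vdash\sigma_1,\sigma_2:\Xi\Rightarrow\Xi'$, $\Xi'\vdash Y:\sigma_1\le_F\sigma_2$ means: for each type or dirt parameter $p\in F^+$, $\Xi'\vdash Y(p):\sigma_1(p)\le\sigma_2(p)$, and for each $p\in F^-$, $\Xi'\vdash Y(p):\sigma_2(p)\le\sigma_1(p)$. PHASES. A phase $\Phi$ takes a context $\Xi$ and a pair $F$ of sets of type and dirt parameters, and (on inputs to which it applies) returns $\Phi(\Xi,F)=(\Xi',\sigma)$ with $\vdash\sigma:\Xi\Rightarrow\Xi'$. Fix a context $\Xi_{\mathrm{use}}$; an instantiation of $\Xi$ is a valid substitution $\vdash\eta:\Xi\Rightarrow\Xi_{\mathrm{use}}$. $\Phi$ is complete if whenever $\Phi(\Xi,F)=(\Xi',\sigma)$, for every instantiation $\vdash\eta:\Xi\Rightarrow\Xi_{\mathrm{use}}$ there are an instantiation $\vdash\eta':\Xi'\Rightarrow\Xi_{\mathrm{use}}$ and a coercion family $\Xi_{\mathrm{use}}\vdash Y_\eta:(\eta'\circ\sigma)\le_F\eta$. SEMANTICS OF TYPES AND COERCIONS. For a family $\mathcal S=\{op:U_{op}\to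 V_{op}\}$ of sets, $T_{\mathcal S}X$ is the set inductively generated by $\mathrm{in}_{\mathtt{return}}(a)$, $a\in X$, and $\mathrm{in}_{op}(u;\kappa)$, $u\in U_{op}$, $\kappa:V_{op}\to T_{\mathcal S}X$; for $f:X\to T_{\mathcal S}Y$, $f^\dagger(\mathrm{in}_{\mathtt{return}}(a))=f(a)$, $f^\dagger(\mathrm{in}_{op}(u;\kappa))=\mathrm{in}_{op}(u;f^\dagger\circ\kappa)$. An assignment $\xi\in[\![\Xi]\!]$ gives: each $\varsigma$ a set $\xi(\varsigma)$; each $\delta$ a set $\xi(\delta)$ of operations of $\Sigma$; each $\alpha:S$ a set $\xi(\alpha)$ with an injection $\iota_\alpha:\xi(\alpha)\hookrightarrow[\![S]\!]_\xi$; for each $\varpi:\Delta\le\Delta'$ the inclusion $\xi(\varpi):[\![\Delta]\!]_\xi\hookrightarrow[\![\Delta']\!]_\xi$ (which is required to exist); each $\omega:A\le A'$ an injection $\xi(\omega):[\![A]\!]_\xi\hookrightarrow[\![A']\!]_\xi$ with $\iota_{A'}\circ\xi(\omega)=\iota_A$. Here $[\![\varsigma]\!]_\xi=\xi(\varsigma)$, $[\![\mathtt{Unit}]\!]_\xi=\{\star\}$, $[\![S_1\to S_2]\!]_\xi=[\![S_1]\!]_\xi\to T_{[\![\Sigma]\!]}[\![S_2]\!]_\xi$, where $[\![\Sigma]\!]=\{op:[\![S_{op}]\!]\to[\![S'_{op}]\!]\}$ with $\vdash A_{op}:S_{op}$, $\vdash B_{op}:S'_{op}$ (it is assumed that $\Sigma$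 is such that sets satisfying these mutually dependent equations exist, and they are fixed). Skeletal interpretation: if $\Xi\vdash A:S$, $(\!|A|\!)_\xi=[\![S]\!]_\xi$ and $(\!|A\,!\,\Delta|\!)_\xi=T_{[\![\Sigma]\!]}[\![S]\!]_\xi$. Dirts: $[\![\delta]\!]_\xi=\xi(\delta)$, $[\![\emptyset]\!]_\xi=\emptyset$, $[\![\{op\}\cup\Delta]\!]_\xi=\{op\}\cup[\![\Delta]\!]_\xi$. Effectful interpretation: $[\![\alpha]\!]_\xi=\xi(\alpha)$, $[\![\mathtt{Unit}]\!]_\xi=\{\star\}$, $[\![A\,!\,\Delta]\!]_\xi=T_{[\![\Sigma]\!]|_{[\![\Delta]\!]_\xi}}([\![A]\!]_\xi)$ (signature restricted to operations in $[\![\Delta]\!]_\xi$), $[\![A\to C]\!]_\xi=\{(f,f')\in((\!|A|\!)_\xi\to(\!|C|\!)_\xi)\times([\![A]\!]_\xi\to[\![C]\!]_\xi)\mid f\circ\iota_A=\iota_C\circ f'\}$, with injections $\iota_A:[\![A]\!]_\xi\hookrightarrow(\!|A|\!)_\xi$, $\iota_C:[\![C]\!]_\xi\hookrightarrow(\!|C|\!)_\xi$: $\iota_\alpha$ given by $\xi$, $\iota_{\mathtt{Unit}}(\star)=\star$, $\iota_{A\to C}(f,f')=f$, $\iota_{A!\Delta}(\mathrm{in}_{\mathtt{return}}(a))=\mathrm{in}_{\mathtt{return}}(\iota_A(a))$, $\iota_{A!\Delta}(\mathrm{in}_{op}(u;\kappa))=\mathrm{in}_{op}(u;\iota_{A!\Delta}\circ\kappa)$.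 Dirt coercions are interpreted as the inclusions; value and computation coercions as injections: $[\![\omega]\!]_\xi=\xi(\omega)$, composition as composition, $\langle\alpha\rangle$ and $\langle\mathtt{Unit}\rangle$ as identities, $[\![\gamma_v\to\gamma_c]\!]_\xi(f,f')=(f,[\![\gamma_c]\!]_\xi\circ f'\circ[\![\gamma_v]\!]_\xi)$, $[\![\gamma_v!\gamma_d]\!]_\xi(\mathrm{in}_{\mathtt{return}}(a))=\mathrm{in}_{\mathtt{return}}([\![\gamma_v]\!]_\xi(a))$, $[\![\gamma_v!\gamma_d]\!]_\xi(\mathrm{in}_{op}(u;\kappa))=\mathrm{in}_{op}(u;[\![\gamma_v!\gamma_d]\!]_\xi\circ\kappa)$. SEMANTICS OF TERMS. $(\!|\Gamma|\!)_\xi$ and $[\![\Gamma]\!]_\xi$ are products over the variables, $\iota_\Gamma$ is the componentwise injection. Skeletal semantics $(\!|v|\!)_\xi:(\!|\Gamma|\!)_\xi\to(\!|A|\!)_\xi$, $(\!|c|\!)_\xi:(\!|\Gamma|\!)_\xi\to(\!|C|\!)_\xi$: variables are projections, $\mathtt{unit}\mapsto\star$, functions $\vec a\mapsto(a'\mapsto(\!|c|\!)_\xi(\vec a,a'))$, casts are ignored, $(\!|\mathtt{return}\,v|\!)_\xi(\vec a)=\mathrm{in}_{\mathtt{return}}((\!|v|\!)_\xi(\vec a))$, $(\!|op\,v\,(y.c)|\!)_\xi(\vec a)=\mathrm{in}_{op}((\!|v|\!)_\xi(\vec a);b\mapsto(\!|c|\!)_\xi(\vec a,b))$, $(\!|\mathtt{do}\,x\leftarrow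 c_1;c_2|\!)_\xi(\vec a)=(a'\mapsto(\!|c_2|\!)_\xi(\vec a,a'))^\dagger((\!|c_1|\!)_\xi(\vec a))$, application is application. The effectful semantics $[\![\Xi;\Gamma\vdash v:A]\!]_\xi:[\![\Gamma]\!]_\xi\to[\![A]\!]_\xi$ is the unique map with $\iota_A\circ[\![v]\!]_\xi=(\!|v|\!)_\xi\circ\iota_\Gamma$, and likewise for computations. *)

(* Defs.v *)
From Stdlib Require List.
From mathcomp Require Import all_boot.

Set Implicit Arguments.
Unset Strict Implicit.
Unset Printing Implicit Defensive.

Section Syntax.
Variable op : finType.

Inductive skel := SPar (s : nat) | SUnit | SArr (S1 S2 : skel).

(* [Dirt O None] is O, [Dirt O (Some d)] is O \cup d; this normal form
   identifies dirts up to reordering and repetition of operations. *)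
Record dirt := Dirt { dops : {set op}; dtail : option nat }.

Definition demp : dirt := Dirt set0 None.
Definition dpar (d : nat) : dirt := Dirt set0 (Some d).
Definition dcons (o : op) (D : dirt) : dirt := Dirt (o |: dops D) (dtail D).

Inductive vty := TPar (a : nat) | TUnit | TArr (A : vty) (C : cty)
with cty := TComp (A : vty) (D : dirt).

Inductive dco :=
| DCPar (w : nat)
| DCComp (g2 g1 : dco)
| DCReflPar (d : nat)
| DCReflEmp
| DCEmpPar (d : nat)
| DCUnion (o : op) (g : dco)
| DCUnionR (o : op) (g : dco).

Inductive vco :=
| VCPar (w : nat)
| VCComp (g2 g1 : vco)
| VCReflPar (a : nat)
| VCReflUnit
| VCArr (gv : vco) (gc : cco)
with cco := CComp (gv : vco) (gd : dco).

(* Term variables are de Bruijn indices: [VFun], [COp] (in its last argument)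
   and [CDo] (in its last argument) each bind index 0. *)
Inductive value :=
| VVar (x : nat)
| VUnit
| VFun (A : vty) (c : computation)
| VCast (v : value) (g : vco)
with computation :=
| CRet (v : value)
| COp (o : op) (v : value) (B : vty) (c : computation)
| CDo (c1 c2 : computation)
| CApp (v1 v2 : value)
| CCast (c : computation) (g : cco).

(* The derived coercions are defined by recursion on a listing of the
   operations of the dirt; [enum] fixes the order. *)
Definition dco_emp (D : dirt) : dco :=
  foldr DCUnionR (if dtail D is Some d then DCEmpPar d else DCReflEmp)
        (enum (dops D)).
Definition dco_refl (D : dirt) : dco :=
  foldr DCUnion (if dtail D is Some d then DCReflPar d else DCReflEmp)
        (enum (dops D)).

Fixpoint vco_refl (A : vty) : vco :=
  match A with
  | TPar a => VCReflPar a
  | TUnit => VCReflUnit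
  | TArr A C => VCArr (vco_refl A) (cco_refl C)
  end
with cco_refl (C : cty) : cco :=
  match C with TComp A D => CComp (vco_refl A) (dco_refl D) end.

Definition dirt_closed (D : dirt) : Prop := dtail D = None.
Fixpoint vty_closed (A : vty) : Prop :=
  match A with
  | TPar _ => False
  | TUnit => True
  | TArr A C => vty_closed A /\ cty_closed C
  end
with cty_closed (C : cty) : Prop :=
  match C with TComp A D => vty_closed A /\ dirt_closed D end.

Inductive param :=
| PSkel (s : nat) | PDirt (d : nat) | PTy (a : nat) | PDco (w : nat)
| PVco (w : nat).

Inductive decl :=
| DSkel (s : nat)
| DDirt (d : nat)
| DTy (a : nat) (S : skel)
| DDco (w : nat) (D1 D2 : dirt)
| DVco (w : nat) (A1 A2 : vty).

Definition decl_param (d : decl) : param :=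
  match d with
  | DSkel s => PSkel s
  | DDirt d => PDirt d
  | DTy a _ => PTy a
  | DDco w _ _ => PDco w
  | DVco w _ _ => PVco w
  end.

Section Kinding.
Variable Xi : seq decl.

Fixpoint wf_skel (S : skel) : Prop :=
  match S with
  | SPar s => List.In (DSkel s) Xi
  | SUnit => True
  | SArr S1 S2 => wf_skel S1 /\ wf_skel S2
  end.

Definition wf_dirt (D : dirt) : Prop :=
  if dtail D is Some d then List.In (DDirt d) Xi else True.

Inductive has_vskel : vty -> skel -> Prop :=
| KPar a S : List.In (DTy a S) Xi -> has_vskel (TPar a) S
| KUnit : has_vskel TUnit SUnit
| KArr A C S1 S2 :
    has_vskel A S1 -> has_cskel C S2 -> has_vskel (TArr A C) (SArr S1 S2)
with has_cskel : cty -> skel -> Prop :=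
| KComp A D S : has_vskel A S -> wf_dirt D -> has_cskel (TComp A D) S.

Definition wf_decl (d : decl) : Prop :=
  match d with
  | DSkel _ | DDirt _ => True
  | DTy _ K => wf_skel K
  | DDco _ D1 D2 => wf_dirt D1 /\ wf_dirt D2
  | DVco _ A1 A2 => exists S, has_vskel A1 S /\ has_vskel A2 S
  end.

Definition wf_ctx : Prop :=
  List.NoDup [seq decl_param d | d <- Xi] /\
  (forall d, List.In d Xi -> wf_decl d).

(* The skeleton of a type as a function: it computes the S of
   [has_vskel A S] (see [has_vskel_skel]), with junk value [SUnit] at
   undeclared parameters. *)
Fixpoint par_skel (ds : seq decl) (a : nat) : skel :=
  match ds with
  | [::] => SUnit
  | DTy b K :: ds' => if b == a then K else par_skel ds' a
  | _ :: ds' => par_skel ds' a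
  end.

Fixpoint vskel (A : vty) : skel :=
  match A with
  | TPar a => par_skel Xi a
  | TUnit => SUnit
  | TArr A C => SArr (vskel A) (cskel C)
  end
with cskel (C : cty) : skel := match C with TComp A _ => vskel A end.

End Kinding.

Record ctx := Ctx { decls :> seq decl; ctx_wf : wf_ctx decls }.

(* Membership premises at the leaves suffice for both sides to be well-formed
   with a common skeleton: see [dco_ty_wf] and [vco_ty_wf]. *)
Inductive dco_ty (Xi : ctx) : dco -> dirt -> dirt -> Prop :=
| DC_par w D D' : List.In (DDco w D D') Xi -> dco_ty Xi (DCPar w) D D'
| DC_comp g2 g1 X Y Z :
    dco_ty Xi g1 X Y -> dco_ty Xi g2 Y Z -> dco_ty Xi (DCComp g2 g1) X Z
| DC_reflpar d :
    List.In (DDirt d) Xi -> dco_ty Xi (DCReflPar d) (dpar d) (dpar d)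
| DC_reflemp : dco_ty Xi DCReflEmp demp demp
| DC_emppar d : List.In (DDirt d) Xi -> dco_ty Xi (DCEmpPar d) demp (dpar d)
| DC_union o g D D' :
    dco_ty Xi g D D' -> dco_ty Xi (DCUnion o g) (dcons o D) (dcons o D')
| DC_unionr o g D D' :
    dco_ty Xi g D D' -> dco_ty Xi (DCUnionR o g) D (dcons o D').

Inductive vco_ty (Xi : ctx) : vco -> vty -> vty -> Prop :=
| VC_par w A A' : List.In (DVco w A A') Xi -> vco_ty Xi (VCPar w) A A'
| VC_comp g2 g1 X Y Z :
    vco_ty Xi g1 X Y -> vco_ty Xi g2 Y Z -> vco_ty Xi (VCComp g2 g1) X Z
| VC_reflpar a S :
    List.In (DTy a S) Xi -> vco_ty Xi (VCReflPar a) (TPar a) (TPar a)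
| VC_reflunit : vco_ty Xi VCReflUnit TUnit TUnit
| VC_arr gv gc A A' C C' :
    vco_ty Xi gv A' A -> cco_ty Xi gc C C' ->
    vco_ty Xi (VCArr gv gc) (TArr A C) (TArr A' C')
with cco_ty (Xi : ctx) : cco -> cty -> cty -> Prop :=
| CC_comp gv gd A A' D D' :
    vco_ty Xi gv A A' -> dco_ty Xi gd D D' ->
    cco_ty Xi (CComp gv gd) (TComp A D) (TComp A' D').

Scheme has_vskel_mut := Induction for has_vskel Sort Prop
  with has_cskel_mut := Induction for has_cskel Sort Prop.
Scheme vco_ty_mut := Induction for vco_ty Sort Prop
  with cco_ty_mut := Induction for cco_ty Sort Prop.
Scheme vty_mut := Induction for vty Sort Prop
  with cty_mut := Induction for cty Sort Prop.

Lemma In_par_skel (ds : seq decl) a S :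
  List.NoDup [seq decl_param d | d <- ds] ->
  List.In (DTy a S) ds -> par_skel ds a = S.
Proof.
elim: ds => [|d ds IH] //= nd; inversion nd as [|? ? nin nd' E]; subst.
case=> [->|ind] /=; first by rewrite eqxx.
have IH' := IH nd' ind.
case: d nd nin => //= b T nd nin; case: eqP => // eba; subst b.
by case: nin; exact: (List.in_map decl_param _ _ ind).
Qed.

Lemma has_vskel_skel (Xi : ctx) A S : has_vskel Xi A S -> vskel Xi A = S.
Proof.
apply: (@has_vskel_mut Xi (fun A S _ => vskel Xi A = S)
                          (fun C S _ => cskel Xi C = S)) => //=.
- by move=> a S'; apply: In_par_skel; case: (ctx_wf Xi).
- by move=> A' C S1 S2 _ -> _ ->.
Qed.

Lemma dco_ty_wf (Xi : ctx) g D D' :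
  dco_ty Xi g D D' -> wf_dirt Xi D /\ wf_dirt Xi D'.
Proof.
elim=> //=.
- by move=> w X Y /(proj2 (ctx_wf Xi)).
- by move=> ? ? X Y Z _ [? _] _ [_ ?].
Qed.

Lemma vco_ty_wf (Xi : ctx) g A A' : vco_ty Xi g A A' ->
  exists S, has_vskel Xi A S /\ has_vskel Xi A' S.
Proof.
apply: (@vco_ty_mut Xi
  (fun _ A A' _ => exists S, has_vskel Xi A S /\ has_vskel Xi A' S)
  (fun _ C C' _ => exists S, has_cskel Xi C S /\ has_cskel Xi C' S)) => //=.
- by move=> w X Y /(proj2 (ctx_wf Xi)).
- move=> _ _ X Y Z _ [S [hX hY]] _ [S' [hY' hZ]]; exists S; split=> //.
  by rewrite -(has_vskel_skel hY) (has_vskel_skel hY').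
- by move=> a S h; exists S; split; constructor.
- by exists SUnit; split; constructor.
- move=> _ _ X X' C C' _ [S [h1 h2]] _ [S' [h3 h4]].
  by exists (SArr S S'); split; constructor.
- move=> _ _ X X' D D' _ [S [h1 h2]] /dco_ty_wf [h3 h4].
  by exists S; split; constructor.
Qed.

Lemma vco_ty_skel (Xi : ctx) g A A' :
  vco_ty Xi g A A' -> vskel Xi A = vskel Xi A'.
Proof.
by case/vco_ty_wf=> S [/has_vskel_skel-> /has_vskel_skel->].
Qed.

Lemma cco_ty_skel (Xi : ctx) g C C' :
  cco_ty Xi g C C' -> cskel Xi C = cskel Xi C'.
Proof. by case=> gv gd A A' D D' /vco_ty_skel. Qed.

Lemma DVco_skel (Xi : ctx) w A A' :
  List.In (DVco w A A') Xi -> vskel Xi A = vskel Xi A'.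
Proof. by move=> h; apply: (vco_ty_skel (g := VCPar w)); constructor. Qed.

(* Only the values at the parameters of the source context matter. *)
Record subst := Subst {
  sub_s : nat -> skel;
  sub_d : nat -> dirt;
  sub_a : nat -> vty;
  sub_dc : nat -> dco;
  sub_vc : nat -> vco
}.

Section Action.
Variable s : subst.

Fixpoint skel_sub (S : skel) : skel :=
  match S with
  | SPar x => sub_s s x
  | SUnit => SUnit
  | SArr S1 S2 => SArr (skel_sub S1) (skel_sub S2)
  end.

Definition dirt_sub (D : dirt) : dirt :=
  if dtail D is Some d
  then Dirt (dops D :|: dops (sub_d s d)) (dtail (sub_d s d))
  else D.

Fixpoint vty_sub (A : vty) : vty :=
  match A with
  | TPar a => sub_a s a
  | TUnit => TUnit
  | TArr A C => TArr (vty_sub A) (cty_sub C)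
  end
with cty_sub (C : cty) : cty :=
  match C with TComp A D => TComp (vty_sub A) (dirt_sub D) end.

Fixpoint dco_sub (g : dco) : dco :=
  match g with
  | DCPar w => sub_dc s w
  | DCComp g2 g1 => DCComp (dco_sub g2) (dco_sub g1)
  | DCReflPar d => dco_refl (sub_d s d)
  | DCReflEmp => DCReflEmp
  | DCEmpPar d => dco_emp (sub_d s d)
  | DCUnion o g => DCUnion o (dco_sub g)
  | DCUnionR o g => DCUnionR o (dco_sub g)
  end.

Fixpoint vco_sub (g : vco) : vco :=
  match g with
  | VCPar w => sub_vc s w
  | VCComp g2 g1 => VCComp (vco_sub g2) (vco_sub g1)
  | VCReflPar a => vco_refl (sub_a s a)
  | VCReflUnit => VCReflUnit
  | VCArr gv gc => VCArr (vco_sub gv) (cco_sub gc)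
  end
with cco_sub (g : cco) : cco :=
  match g with CComp gv gd => CComp (vco_sub gv) (dco_sub gd) end.

Fixpoint val_sub (v : value) : value :=
  match v with
  | VVar x => VVar x
  | VUnit => VUnit
  | VFun A c => VFun (vty_sub A) (cmp_sub c)
  | VCast v g => VCast (val_sub v) (vco_sub g)
  end
with cmp_sub (c : computation) : computation :=
  match c with
  | CRet v => CRet (val_sub v)
  | COp o v B c => COp o (val_sub v) (vty_sub B) (cmp_sub c)
  | CDo c1 c2 => CDo (cmp_sub c1) (cmp_sub c2)
  | CApp v1 v2 => CApp (val_sub v1) (val_sub v2)
  | CCast c g => CCast (cmp_sub c) (cco_sub g)
  end.

End Action.

(* [subst_comp s' s] is s' \circ s. *)
Definition subst_comp (s' s : subst) : subst := {|
  sub_s := fun x => skel_sub s' (sub_s s x);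
  sub_d := fun x => dirt_sub s' (sub_d s x);
  sub_a := fun x => vty_sub s' (sub_a s x);
  sub_dc := fun x => dco_sub s' (sub_dc s x);
  sub_vc := fun x => vco_sub s' (sub_vc s x)
|}.

Record valid_subst (s : subst) (Xi Xi' : ctx) : Prop := ValidSubst {
  valid_s : forall x, List.In (DSkel x) Xi -> wf_skel Xi' (sub_s s x);
  valid_d : forall d, List.In (DDirt d) Xi -> wf_dirt Xi' (sub_d s d);
  valid_a : forall a S, List.In (DTy a S) Xi ->
    has_vskel Xi' (sub_a s a) (skel_sub s S);
  valid_dc : forall w D1 D2, List.In (DDco w D1 D2) Xi ->
    dco_ty Xi' (sub_dc s w) (dirt_sub s D1) (dirt_sub s D2);
  valid_vc : forall w A1 A2, List.In (DVco w A1 A2) Xi ->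
    vco_ty Xi' (sub_vc s w) (vty_sub s A1) (vty_sub s A2)
}.

Inductive tdparam := FTy (a : nat) | FDirt (d : nat).

Record polset := PolSet { pos : tdparam -> Prop; neg : tdparam -> Prop }.

Definition pol0 : polset := PolSet (fun _ => False) (fun _ => False).
Definition pol1 (p : tdparam) : polset :=
  PolSet (fun q => q = p) (fun _ => False).
Definition polU (F G : polset) : polset :=
  PolSet (fun p => pos F p \/ pos G p) (fun p => neg F p \/ neg G p).
Definition pol_bar (F : polset) : polset := PolSet (neg F) (pos F).

Definition fp_dirt (D : dirt) : polset :=
  if dtail D is Some d then pol1 (FDirt d) else pol0.
Fixpoint fp_vty (A : vty) : polset :=
  match A with
  | TPar a => pol1 (FTy a)
  | TUnit => pol0
  | TArr A C => polU (pol_bar (fp_vty A)) (fp_cty C)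
  end
with fp_cty (C : cty) : polset :=
  match C with TComp A D => polU (fp_vty A) (fp_dirt D) end.

Record cofam := CoFam { fam_a : nat -> vco; fam_d : nat -> dco }.

Definition td_in (Xi : ctx) (p : tdparam) : Prop :=
  match p with
  | FTy a => exists S, List.In (DTy a S) Xi
  | FDirt d => List.In (DDirt d) Xi
  end.

Definition fam_at (Xi' : ctx) (Y : cofam) (s1 s2 : subst) (p : tdparam) : Prop :=
  match p with
  | FTy a => vco_ty Xi' (fam_a Y a) (sub_a s1 a) (sub_a s2 a)
  | FDirt d => dco_ty Xi' (fam_d Y d) (sub_d s1 d) (sub_d s2 d)
  end.

(* For s1, s2 : Xi => Xi'; parameters of F outside Xi, at which substitutions
   are meaningless, impose no condition. *)
Definition fam_le (Xi Xi' : ctx) (Y : cofam) (F : polset) (s1 s2 : subst)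
    : Prop :=
  forall p, td_in Xi p ->
    (pos F p -> fam_at Xi' Y s1 s2 p) /\ (neg F p -> fam_at Xi' Y s2 s1 p).

Record phase := Phase {
  run :> ctx -> polset -> option (ctx * subst);
  run_valid : forall Xi F Xi' s,
    run Xi F = Some (Xi', s) -> valid_subst s Xi Xi'
}.

Definition complete (Xuse : ctx) (Phi : phase) : Prop :=
  forall Xi F Xi' s, Phi Xi F = Some (Xi', s) ->
  forall eta, valid_subst eta Xi Xuse ->
  exists eta' Y, valid_subst eta' Xi' Xuse /\
    fam_le Xi Xuse Y F (subst_comp eta' s) eta.

End Syntax.

Arguments TUnit {op}.
Arguments TPar {op} a.
Arguments VCPar {op} w.
Arguments VUnit {op}.
Arguments VVar {op} x.

(* The elements of [op] are exactly the operations of the global signature, so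
   that an operation is never outside of it. *)
Record signature := Signature {
  op :> finType;
  argT : op -> vty op;
  resT : op -> vty op;
  argT_closed : forall o, vty_closed (argT o);
  resT_closed : forall o, vty_closed (resT o);
  resT_not_arr : forall o A C, resT o <> TArr A C
}.

(* Typing judgements are Type-valued, the semantics being defined by recursion
   on derivations. *)
Inductive tvar (T : Type) : seq T -> nat -> T -> Type :=
| TV_here G A : tvar (A :: G) 0 A
| TV_there G x A B : tvar G x A -> tvar (B :: G) x.+1 A.

Inductive has_vty (Sg : signature) (Xi : ctx Sg) :
  seq (vty Sg) -> value Sg -> vty Sg -> Type :=
| T_var G x A : tvar G x A -> has_vty Xi G (VVar x) A
| T_unit G : has_vty Xi G VUnit TUnit
| T_fun G A S c C : has_vskel Xi A S -> has_cty Xi (A :: G) c C ->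
    has_vty Xi G (VFun A c) (TArr A C)
| T_vcast G v g A A' : has_vty Xi G v A -> vco_ty Xi g A A' ->
    has_vty Xi G (VCast v g) A'
with has_cty (Sg : signature) (Xi : ctx Sg) :
  seq (vty Sg) -> computation Sg -> cty Sg -> Type :=
| T_ret G v A : has_vty Xi G v A -> has_cty Xi G (CRet v) (TComp A (demp Sg))
| T_op G o v c A D : has_vty Xi G v (argT o) ->
    has_cty Xi (resT o :: G) c (TComp A D) -> o \in dops D ->
    has_cty Xi G (COp o v (resT o) c) (TComp A D)
| T_do G c1 c2 A A' D : has_cty Xi G c1 (TComp A D) ->
    has_cty Xi (A :: G) c2 (TComp A' D) ->
    has_cty Xi G (CDo c1 c2) (TComp A' D)
| T_app G v1 v2 A C : has_vty Xi G v1 (TArr A C) -> has_vty Xi G v2 A ->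
    has_cty Xi G (CApp v1 v2) C
| T_ccast G c g C C' : has_cty Xi G c C -> cco_ty Xi g C C' ->
    has_cty Xi G (CCast c g) C'.

(* The set T_S X for the family S = {i : U i -> V i}. *)
Inductive free (I : Type) (U V : I -> Type) (X : Type) : Type :=
| InRet (a : X)
| InOp (i : I) (u : U i) (k : V i -> free U V X).
Arguments InRet {I U V X} a.
Arguments InOp {I U V X} i u k.

Fixpoint bind (I : Type) (U V : I -> Type) (X Y : Type) (f : X -> free U V Y)
    (t : free U V X) : free U V Y :=
  match t with
  | InRet a => f a
  | InOp i u k => InOp i u (fun b => bind f (k b))
  end.

Definition coe (X Y : Type) (e : X = Y) (x : X) : Y := eq_rect X id x Y e.

Section SkelSem.
Variables (Sg : signature) (U V : Sg -> Type).

Fixpoint skel_sem (r : nat -> Type) (S : skel) : Type :=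
  match S with
  | SPar s => r s
  | SUnit => unit
  | SArr S1 S2 => skel_sem r S1 -> free U V (skel_sem r S2)
  end.

(* The skeleton of a closed type, interpreted with no parameters. *)
Definition ground_sem (A : vty Sg) : Type :=
  skel_sem (fun _ => Empty_set) (vskel [::] A).

Lemma ground_semE (r : nat -> Type) (Xi : seq (decl Sg)) (A : vty Sg) :
  vty_closed A -> skel_sem r (vskel Xi A) = ground_sem A.
Proof.
rewrite /ground_sem; move: A.
apply: (@vty_mut Sg
  (fun A => vty_closed A -> skel_sem r (vskel Xi A) =
     skel_sem (fun _ => Empty_set) (vskel [::] A))
  (fun C => cty_closed C -> skel_sem r (cskel Xi C) =
     skel_sem (fun _ => Empty_set) (cskel [::] C))) => //=.
- by move=> A IHA C IHC [/IHA-> /IHC->].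
- by move=> A IHA D [/IHA->].
Qed.

End SkelSem.

(* A fixed solution of the mutually dependent equations U_op = [[S_op]],
   V_op = [[S'_op]], where equality of sets is rendered as bijection. *)
Record sig_sem (Sg : signature) := SigSem {
  argS : Sg -> Type;
  resS : Sg -> Type;
  to_argS : forall o, ground_sem argS resS (argT o) -> argS o;
  of_resS : forall o, resS o -> ground_sem argS resS (resT o);
  to_argS_bij : forall o, bijective (to_argS (o := o));
  of_resS_bij : forall o, bijective (of_resS (o := o))
}.

Section TypeSem.
Variables (Sg : signature) (M : sig_sem Sg) (Xi : ctx Sg).

Notation sk := (skel_sem (@argS Sg M) (@resS Sg M)).

Definition Tall (X : Type) : Type := free (@argS Sg M) (@resS Sg M) X.
Definition Tres (E : {set Sg}) (X : Type) : Type :=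
  free (fun o : {o : Sg | o \in E} => argS M (val o))
       (fun o : {o : Sg | o \in E} => resS M (val o)) X.

Fixpoint Tinc (E : {set Sg}) (X Y : Type) (f : X -> Y) (t : Tres E X) : Tall Y :=
  match t with
  | InRet a => InRet (f a)
  | InOp o u k => InOp (val o) u (fun b => Tinc f (k b))
  end.

(* The part of an assignment on which the interpretation of types depends.
   Values at parameters not in Xi are irrelevant. *)
Record assign0 := Assign0 {
  as_s : nat -> Type;
  as_d : nat -> {set Sg};
  as_a : nat -> Type;
  as_iota : forall a, as_a a -> sk as_s (par_skel Xi a)
}.

Section Interp.
Variable xi : assign0.

Definition vsk (A : vty Sg) : Type := sk (as_s xi) (vskel Xi A).
Definition csk (C : cty Sg) : Type := Tall (sk (as_s xi) (cskel Xi C)).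

Definition dirt_eff (D : dirt Sg) : {set Sg} :=
  dops D :|: (if dtail D is Some d then as_d xi d else set0).

Record over (Y : Type) := Over { car : Type; inc : car -> Y }.

(* [car] is the effectful interpretation and [inc] its injection iota; they are
   mutually dependent at arrow types. *)
Fixpoint vover (A : vty Sg) : over (vsk A) :=
  match A return over (vsk A) with
  | TPar a => Over (@as_iota xi a)
  | TUnit => @Over unit unit id
  | TArr A C =>
      @Over (vsk A -> csk C)
        {p : (vsk A -> csk C) * (car (vover A) -> car (tover C)) |
          forall a, p.1 (@inc _ (vover A) a) = @inc _ (tover C) (p.2 a)}
        (fun p => (proj1_sig p).1)
  end
with tover (C : cty Sg) : over (csk C) :=
  match C return over (csk C) with
  | TComp A D =>
      @Over (Tall (vsk A)) (Tres (dirt_eff D) (car (vover A)))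
        (@Tinc (dirt_eff D) _ _ (@inc _ (vover A)))
  end.

Definition veff (A : vty Sg) : Type := car (vover A).
Definition ceff (C : cty Sg) : Type := car (tover C).
Definition viota (A : vty Sg) : veff A -> vsk A := @inc _ (vover A).
Definition ciota (C : cty Sg) : ceff C -> csk C := @inc _ (tover C).

(* The skeletal interpretation only depends on the skeleton. *)
Definition vsk_coe A A' (e : vskel Xi A = vskel Xi A') : vsk A -> vsk A' :=
  coe (f_equal (sk (as_s xi)) e).
Definition csk_coe C C' (e : cskel Xi C = cskel Xi C') : csk C -> csk C' :=
  coe (f_equal (fun S => Tall (sk (as_s xi) S)) e).

End Interp.

Record assignment := Assignment {
  as0 :> assign0;
  as_iota_inj : forall a, injective (@as_iota as0 a);
  as_dc : forall w D D', List.In (DDco w D D') Xi ->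
    dirt_eff as0 D \subset dirt_eff as0 D';
  as_vc : forall w A A', List.In (DVco w A A') Xi -> veff as0 A -> veff as0 A';
  as_vc_inj : forall w A A' (h : List.In (DVco w A A') Xi),
    injective (as_vc h);
  as_vc_iota : forall w A A' (h : List.In (DVco w A A') Xi) (x : veff as0 A),
    viota (as_vc h x) = vsk_coe (DVco_skel h) (viota x)
}.

Section TermSem.
Variable xi : assignment.

Fixpoint env (I : vty Sg -> Type) (G : seq (vty Sg)) : Type :=
  if G is A :: G' then (env I G' * I A)%type else unit.

Fixpoint env_map (I J : vty Sg -> Type) (f : forall A, I A -> J A)
    (G : seq (vty Sg)) : env I G -> env J G :=
  match G return env I G -> env J G with
  | [::] => id
  | A :: G' => fun a => (env_map f a.1, f A a.2)
  end.

Fixpoint env_proj (I : vty Sg -> Type) G x A (p : tvar G x A) : env I G -> I A :=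
  match p in tvar G _ A return env I G -> I A with
  | TV_here _ _ => fun a => a.2
  | TV_there _ _ _ _ q => fun a => env_proj q a.1
  end.

(* At an operation, the skeletal meaning of its closed argument and result
   types is identified with the fixed sets of the signature. *)
Definition op_arg (o : Sg) (a : vsk xi (argT o)) : argS M o :=
  to_argS (coe (ground_semE _ _ (as_s xi) Xi (argT_closed o)) a).
Definition op_res (o : Sg) (b : resS M o) : vsk xi (resT o) :=
  coe (esym (ground_semE _ _ (as_s xi) Xi (resT_closed o))) (of_resS b).

Fixpoint vsem G v A (d : has_vty Xi G v A) : env (vsk xi) G -> vsk xi A :=
  match d in has_vty _ G _ A return env (vsk xi) G -> vsk xi A with
  | T_var _ _ _ p => env_proj p
  | T_unit _ => fun _ => tt
  | T_fun _ _ _ _ _ _ dc => fun a a' => csem dc (a, a')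
  | T_vcast _ _ _ _ _ dv h => fun a => vsk_coe (vco_ty_skel h) (vsem dv a)
  end
with csem G c C (d : has_cty Xi G c C) : env (vsk xi) G -> csk xi C :=
  match d in has_cty _ G _ C return env (vsk xi) G -> csk xi C with
  | T_ret _ _ _ dv => fun a => InRet (vsem dv a)
  | T_op _ o _ _ _ _ dv dc _ => fun a =>
      InOp o (op_arg (vsem dv a)) (fun b => csem dc (a, op_res b))
  | T_do _ _ _ _ _ _ d1 d2 => fun a =>
      bind (fun a' => csem d2 (a, a')) (csem d1 a)
  | T_app _ _ _ _ _ d1 d2 => fun a => vsem d1 a (vsem d2 a)
  | T_ccast _ _ _ _ _ dc h => fun a => csk_coe (cco_ty_skel h) (csem dc a)
  end.

(* [f] satisfies the equation characterizing the effectful semantics of the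
   judgement Xi; G |- v : A. *)
Definition is_veff_sem G v A (f : env (veff xi) G -> veff xi A) : Prop :=
  exists d : has_vty Xi G v A, forall a,
    viota (f a) = vsem d (env_map (@viota xi) a).

(* The judgements Xi; G |- v : A and Xi; G |- v' : A have effectful semantics,
   in each case a unique map, and the two maps are equal. *)
Definition same_veff_sem G v v' A : Prop :=
  exists f : env (veff xi) G -> veff xi A,
    unique (fun f => is_veff_sem v f) f /\ unique (fun f => is_veff_sem v' f) f.

End TermSem.
End TypeSem.

(* Main.v *)
(** Completeness gives [eta'] and coercions at the parameters of [A], which
    assemble, contravariantly at domains, into [eta' (s A) <= eta A]. The terms
    [eta v] and [eta' (s v)] differ only in type annotations and coercions, both
    invisible to the skeletal semantics. However, their subterms may live at
    different skeletons, since [eta] and [eta' \o s] need not agree on parameters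
    absent from [A]; so the two skeletal semantics are compared by a logical
    relation between arbitrary pairs of skeletons that is equality on the
    diagonal. The same relation shows that the semantics does not depend on the
    typing derivation. Injectivity of iota then transfers the equality to the
    effectful semantics, whose existence amounts to the skeletal semantics
    preserving the image of iota. *)
From Stdlib Require Import FunctionalExtensionality ProofIrrelevance.
From Stdlib Require Import IndefiniteDescription Eqdep_dec.
Require Import Defs.
From mathcomp Require Import all_boot.

Set Implicit Arguments.
Unset Strict Implicit.
Unset Printing Implicit Defensive.

Scheme has_vty_ind2 := Induction for has_vty Sort Prop
  with has_cty_ind2 := Induction for has_cty Sort Prop.
Combined Scheme vco_cco_ty_ind from vco_ty_mut, cco_ty_mut.
(* Derivations live in [Type], so carrying them along a substitution needs an eliminator into
   [Type]. *)
Scheme has_vty_rect2 := Minimality for has_vty Sort Type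
  with has_cty_rect2 := Minimality for has_cty Sort Type.
Scheme value_ind2 := Induction for value Sort Prop
  with computation_ind2 := Induction for computation Sort Prop.

(** * Substitution on dirts, types and coercions *)

Section Substitution.
Variable op : finType.
Implicit Types (s : subst op) (D : dirt op) (A : vty op).

(** Links derived coercions, which are folds over a listing of operations, to dirts in normal
    form. *)
Lemma foldr_dcons D (O : {set op}) :
  foldr (@dcons op) D (enum O) = Dirt (O :|: dops D) (dtail D).
Proof.
have E (os : seq op) :
    foldr (@dcons op) D os = Dirt ([set x in os] :|: dops D) (dtail D).
  elim: os => [|o os IH] /=.
    by case: D => E t /=; congr Dirt; apply/setP=> x; rewrite !inE.
  by rewrite IH /dcons /=; congr Dirt; apply/setP=> x; rewrite !inE orbA.
by rewrite E; congr Dirt; apply/setP=> x; rewrite !inE mem_enum.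
Qed.

Lemma dirt_sub_dcons s o D : dirt_sub s (dcons o D) = dcons o (dirt_sub s D).
Proof.
by case: D => O [d|] //; rewrite /dirt_sub /dcons /= setUA.
Qed.

Lemma dirt_sub_comp s' s D :
  dirt_sub (subst_comp s' s) D = dirt_sub s' (dirt_sub s D).
Proof.
case: D => O [d|] //=; rewrite /dirt_sub /=.
by case: (sub_d s d) => O' [d'|] //=; rewrite /dirt_sub /= ?setUA.
Qed.

Lemma vty_sub_comp s' s A :
  vty_sub (subst_comp s' s) A = vty_sub s' (vty_sub s A).
Proof.
move: A; apply: (@vty_mut op
  (fun A => vty_sub (subst_comp s' s) A = vty_sub s' (vty_sub s A))
  (fun C => cty_sub (subst_comp s' s) C = cty_sub s' (cty_sub s C))) => //=.
- by move=> A -> C ->.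
- by move=> A -> D; rewrite dirt_sub_comp.
Qed.

Lemma vty_sub_closed s A : vty_closed A -> vty_sub s A = A.
Proof.
move: A; apply: (@vty_mut op
  (fun A => vty_closed A -> vty_sub s A = A)
  (fun C => cty_closed C -> cty_sub s C = C)) => //=.
- by move=> A IHA C IHC [/IHA-> /IHC->].
- by move=> A IHA [O t] [/IHA-> /= E]; rewrite /dirt_closed /= in E; subst t.
Qed.

Section Context.
Variable Xi : ctx op.

Lemma dco_ty_unions g D D' (O : {set op}) : dco_ty Xi g D D' ->
  dco_ty Xi (foldr (@DCUnion op) g (enum O))
    (Dirt (O :|: dops D) (dtail D)) (Dirt (O :|: dops D') (dtail D')).
Proof.
move=> h; rewrite -!foldr_dcons.
by elim: (enum O) => //= o os IH; constructor.
Qed.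

Lemma dco_ty_unionsr g D D' (O : {set op}) : dco_ty Xi g D D' ->
  dco_ty Xi (foldr (@DCUnionR op) g (enum O))
    D (Dirt (O :|: dops D') (dtail D')).
Proof.
move=> h; rewrite -!foldr_dcons.
by elim: (enum O) => //= o os IH; constructor.
Qed.

Lemma dco_refl_ty D : wf_dirt Xi D -> dco_ty Xi (dco_refl D) D D.
Proof.
case: D => O [d|]; rewrite /wf_dirt /dco_refl /= => h.
  by have := dco_ty_unions O (DC_reflpar h); rewrite /= setU0.
by have := dco_ty_unions O (DC_reflemp Xi); rewrite /= setU0.
Qed.

Lemma dco_emp_ty D : wf_dirt Xi D -> dco_ty Xi (dco_emp D) (demp op) D.
Proof.
case: D => O [d|]; rewrite /wf_dirt /dco_emp /= => h.
  by have := dco_ty_unionsr O (DC_emppar h); rewrite /= setU0.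
by have := dco_ty_unionsr O (DC_reflemp Xi); rewrite /= setU0.
Qed.

Lemma vco_refl_ty A S : has_vskel Xi A S -> vco_ty Xi (vco_refl A) A A.
Proof.
apply: (@has_vskel_mut op Xi
  (fun A S _ => vco_ty Xi (vco_refl A) A A)
  (fun C S _ => cco_ty Xi (cco_refl C) C C)) => //=.
- by move=> a K h; econstructor; exact: h.
- by constructor.
- by move=> *; constructor.
- by move=> *; constructor=> //; apply: dco_refl_ty.
Qed.

Lemma closed_has_vskel A : vty_closed A -> exists S, has_vskel Xi A S.
Proof.
move: A; apply: (@vty_mut op
  (fun A => vty_closed A -> exists S, has_vskel Xi A S)
  (fun C => cty_closed C -> exists S, has_cskel Xi C S)) => //=.
- by move=> _; exists SUnit; constructor.
- move=> A IHA C IHC [/IHA [S hA] /IHC [S' hC]].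
  by exists (SArr S S'); constructor.
- move=> A IHA D [/IHA [S hA] E]; exists S; constructor=> //.
  by rewrite /wf_dirt E.
Qed.

End Context.

Section Valid.
Variables (s : subst op) (Xi Xi' : ctx op).
Hypothesis s_valid : valid_subst s Xi Xi'.

Lemma wf_dirt_sub D : wf_dirt Xi D -> wf_dirt Xi' (dirt_sub s D).
Proof.
by case: D => O [d|] //; rewrite /wf_dirt /dirt_sub /=; apply: valid_d s_valid _.
Qed.

Lemma has_vskel_sub A S :
  has_vskel Xi A S -> has_vskel Xi' (vty_sub s A) (skel_sub s S).
Proof.
apply: (@has_vskel_mut op Xi
  (fun A S _ => has_vskel Xi' (vty_sub s A) (skel_sub s S))
  (fun C S _ => has_cskel Xi' (cty_sub s C) (skel_sub s S))) => //=.
- by move=> a K; apply: valid_a s_valid _ _.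
- by constructor.
- by move=> *; constructor.
- by move=> *; constructor=> //; apply: wf_dirt_sub.
Qed.

Lemma dco_ty_sub g D D' : dco_ty Xi g D D' ->
  dco_ty Xi' (dco_sub s g) (dirt_sub s D) (dirt_sub s D').
Proof.
have Epar d : dirt_sub s (dpar op d) = sub_d s d.
  by rewrite /dirt_sub /dpar /= set0U; case: (sub_d s d).
elim=> {g D D'} /=.
- by move=> w D D'; apply: valid_dc s_valid _ _ _.
- by move=> g2 g1 X Y Z _ h1 _ h2; econstructor; eassumption.
- by move=> d hd; rewrite Epar; apply/dco_refl_ty/(valid_d s_valid).
- by constructor.
- by move=> d hd; rewrite Epar; apply/dco_emp_ty/(valid_d s_valid).
- by move=> *; rewrite !dirt_sub_dcons; constructor.
- by move=> *; rewrite !dirt_sub_dcons; constructor.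
Qed.

Lemma vco_ty_sub g A A' : vco_ty Xi g A A' ->
  vco_ty Xi' (vco_sub s g) (vty_sub s A) (vty_sub s A').
Proof.
apply: (@vco_ty_mut op Xi
  (fun g A A' _ => vco_ty Xi' (vco_sub s g) (vty_sub s A) (vty_sub s A'))
  (fun g C C' _ => cco_ty Xi' (cco_sub s g) (cty_sub s C) (cty_sub s C')))
  => //=.
- by move=> w X X'; apply: valid_vc s_valid _ _ _.
- by move=> g2 g1 X Y Z _ h1 _ h2; econstructor; eassumption.
- by move=> a S h; apply: vco_refl_ty; apply: (valid_a s_valid h).
- by constructor.
- by move=> *; constructor.
- by move=> *; constructor=> //; apply: dco_ty_sub.
Qed.

Lemma cco_ty_sub g C C' : cco_ty Xi g C C' ->
  cco_ty Xi' (cco_sub s g) (cty_sub s C) (cty_sub s C').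
Proof.
by case=> gv gd A A' D D' hv hd; constructor;
  [apply: vco_ty_sub | apply: dco_ty_sub].
Qed.

End Valid.

(** * From coercion families to coercions between types *)

Section Family.
Variables (Xi Xi' : ctx op) (Y : cofam op).

Lemma fam_leW F G s1 s2 :
  (forall p, pos F p -> pos G p) -> (forall p, neg F p -> neg G p) ->
  fam_le Xi Xi' Y G s1 s2 -> fam_le Xi Xi' Y F s1 s2.
Proof. by move=> hp hn h p /h [h1 h2]; split=> [/hp|/hn]. Qed.

Lemma fam_le_bar F s1 s2 :
  fam_le Xi Xi' Y (pol_bar F) s1 s2 -> fam_le Xi Xi' Y F s2 s1.
Proof. by move=> h p /h [h1 h2]. Qed.

Lemma fam_dirt s1 s2 D : wf_dirt Xi D -> fam_le Xi Xi' Y (fp_dirt D) s1 s2 ->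
  exists g, dco_ty Xi' g (dirt_sub s1 D) (dirt_sub s2 D).
Proof.
case: D => O [d|]; rewrite /wf_dirt /fp_dirt /= => hd h.
  have /= [hp _] := h (FDirt d) hd.
  by exists (foldr (@DCUnion op) (fam_d Y d) (enum O));
    apply: (dco_ty_unions O (hp (erefl _))).
by exists (dco_refl (Dirt O None)); apply: dco_refl_ty.
Qed.

(** The two substitutions stay quantified in the induction because the domain of an arrow exchanges
    them, by [fam_le_bar]. *)
Lemma fam_vty A S : has_vskel Xi A S -> forall s1 s2,
  fam_le Xi Xi' Y (fp_vty A) s1 s2 ->
  exists g, vco_ty Xi' g (vty_sub s1 A) (vty_sub s2 A).
Proof.
apply: (@has_vskel_mut op Xi
  (fun A S _ => forall s1 s2, fam_le Xi Xi' Y (fp_vty A) s1 s2 ->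
     exists g, vco_ty Xi' g (vty_sub s1 A) (vty_sub s2 A))
  (fun C S _ => forall s1 s2, fam_le Xi Xi' Y (fp_cty C) s1 s2 ->
     exists g, cco_ty Xi' g (cty_sub s1 C) (cty_sub s2 C))) => //=.
- move=> a K h s1 s2 hf; exists (fam_a Y a).
  by have /= [hp _] := hf (FTy a) (ex_intro _ K h); apply: hp.
- by move=> s1 s2 _; exists (VCReflUnit op); constructor.
- move=> A1 C S1 S2 _ IHA _ IHC s1 s2 hf.
  have [|gv hv] := IHA s2 s1.
    by apply: fam_le_bar; apply: fam_leW hf => p; left.
  have [|gc hc] := IHC s1 s2; first by apply: fam_leW hf => p; right.
  by exists (VCArr gv gc); constructor.
- move=> A1 D S1 _ IHA hD s1 s2 hf.
  have [|gv hv] := IHA s1 s2; first by apply: fam_leW hf => p; left.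
  have [|gd hd] := @fam_dirt s1 s2 D hD; first by apply: fam_leW hf => p; right.
  by exists (CComp gv gd); constructor.
Qed.

End Family.
End Substitution.

(** * Typing: skeletons, stability under substitution, erasure *)

Section Typing.
Variables (Sg : signature).
Implicit Types (G : seq (vty Sg)).

Lemma tvar_map (T T' : Type) (f : T -> T') (G : seq T) x A :
  tvar G x A -> tvar (map f G) x (f A).
Proof. by elim=> *; constructor. Qed.

Lemma tvar_inv (T : Type) (P : T -> Prop) B (G : seq T) :
  P B -> (forall x A, tvar G x A -> P A) ->
  forall x A, tvar (B :: G) x A -> P A.
Proof.
move=> hB hG x A; move EG: (B :: G) => G' p.
by case: p EG => [G0 A0 [<- _]|G0 y A0 B0 p [_ EG]] //; subst G0; apply: hG p.
Qed.

(** Typing judgements do not record that their types have a skeleton; it is recovered here so that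
    [fam_vty] applies to the type of the value. *)
Lemma has_vty_skel (Xi : ctx Sg) G v A :
  (forall x B, tvar G x B -> exists S, has_vskel Xi B S) ->
  has_vty Xi G v A -> exists S, has_vskel Xi A S.
Proof.
move=> hG d; move: G v A d hG.
apply: (@has_vty_ind2 Sg Xi
  (fun G v A _ => (forall x B, tvar G x B -> exists S, has_vskel Xi B S) ->
     exists S, has_vskel Xi A S)
  (fun G c C _ => (forall x B, tvar G x B -> exists S, has_vskel Xi B S) ->
     exists S, has_cskel Xi C S)).
- by move=> G x A p hG; apply: hG p.
- by move=> G hG; exists SUnit; constructor.
- move=> G A S c C hA _ IH hG.
  have [|S' hC] := IH; first by apply: tvar_inv hG; exists S.
  by exists (SArr S S'); constructor.
- by move=> G v g A A' _ _ /vco_ty_wf [S [_ h]] _; exists S.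
- by move=> G v A _ IH /IH [S h]; exists S; constructor.
- move=> G o v c A D _ _ _ IH _ hG; apply: IH.
  by apply: tvar_inv hG; apply/closed_has_vskel/resT_closed.
- move=> G c1 c2 A A' D _ IH1 _ IH2 hG; apply: IH2.
  apply: tvar_inv (hG); have [S h] := IH1 hG.
  by inversion h; subst; exists S.
- move=> G v1 v2 A C _ IH _ _ /IH [S h].
  by inversion h; subst; exists S2.
- move=> G c g C C' _ _ h _; case: h => gv gd A A' D D' /vco_ty_wf [S [_ h]].
  by case/dco_ty_wf=> _ hD; exists S; constructor.
Qed.

Lemma has_vty_sub (Xi Xi' : ctx Sg) (s : subst Sg) : valid_subst s Xi Xi' ->
  forall G v A, has_vty Xi G v A ->
  has_vty Xi' (map (vty_sub s) G) (val_sub s v) (vty_sub s A).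
Proof.
move=> hs; apply: (@has_vty_rect2 Sg Xi
  (fun G v A => has_vty Xi' (map (vty_sub s) G) (val_sub s v) (vty_sub s A))
  (fun G c C => has_cty Xi' (map (vty_sub s) G) (cmp_sub s c) (cty_sub s C)))
  => /=.
- by move=> G x A p; constructor; apply: tvar_map.
- by move=> G; constructor.
- move=> G A S c C hA _ IH; apply: T_fun IH.
  exact: has_vskel_sub hs _ _ hA.
- by move=> G v g A A' _ IH h; apply: T_vcast IH _; apply: vco_ty_sub h.
- by move=> G v A _ IH; apply: T_ret IH.
- move=> G o v c A D _ + _ + ho.
  (* [T_op] demands exactly the signature types; being closed, they are fixed by [s]. *)
  rewrite (vty_sub_closed s (resT_closed o)) (vty_sub_closed s (argT_closed o)).
  move=> dv dc; apply: T_op => //.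
  (* A substitution can only enlarge the operations of a dirt. *)
  by rewrite /dirt_sub; case: (dtail D) => // d; rewrite inE ho.
- by move=> G c1 c2 A A' D _ IH1 _ IH2; apply: T_do IH1 IH2.
- by move=> G v1 v2 A C _ IH1 _ IH2; apply: T_app IH1 IH2.
- by move=> G c g C C' _ IH h; apply: T_ccast IH _; apply: cco_ty_sub h.
Qed.

(* Casts are kept, so that two terms with the same image differ only in their
   type annotations and in the coercions of their casts. *)
Fixpoint forget_val (v : value Sg) : value Sg :=
  match v with
  | VVar x => VVar x
  | VUnit => VUnit
  | VFun _ c => VFun TUnit (forget_cmp c)
  | VCast v _ => VCast (forget_val v) (VCReflUnit Sg)
  end
with forget_cmp (c : computation Sg) : computation Sg :=
  match c with
  | CRet v => CRet (forget_val v)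
  | COp o v _ c => COp o (forget_val v) TUnit (forget_cmp c)
  | CDo c1 c2 => CDo (forget_cmp c1) (forget_cmp c2)
  | CApp v1 v2 => CApp (forget_val v1) (forget_val v2)
  | CCast c _ => CCast (forget_cmp c) (cco_refl (TComp TUnit (demp Sg)))
  end.

Lemma forget_val_sub s v : forget_val (val_sub s v) = forget_val v.
Proof.
move: v; apply: (@value_ind2 Sg
  (fun v => forget_val (val_sub s v) = forget_val v)
  (fun c => forget_cmp (cmp_sub s c) = forget_cmp c)) => //=.
- by move=> A c ->.
- by move=> v -> g.
- by move=> v ->.
- by move=> o v -> B c ->.
- by move=> c1 -> c2 ->.
- by move=> v1 -> v2 ->.
- by move=> c -> g.
Qed.

End Typing.

(** * Relational lifting to computation trees *)

Section FreeRel.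
Variables (I : Type) (U V : I -> Type).

(** Operations and their arguments must coincide, as they come from sets fixed by the signature;
    only returned values may belong to different sets. *)
Inductive free_rel (X Y : Type) (Q : X -> Y -> Prop) :
  free U V X -> free U V Y -> Prop :=
| FR_ret a b : Q a b -> free_rel Q (InRet a) (InRet b)
| FR_op i u k k' : (forall b, free_rel Q (k b) (k' b)) ->
    free_rel Q (InOp i u k) (InOp i u k').

Lemma free_rel_eq (X : Type) (Q : X -> X -> Prop) :
  (forall a b, Q a b <-> a = b) -> forall t t', free_rel Q t t' <-> t = t'.
Proof.
move=> hQ t t'; split=> [|<-].
  elim=> [a b /hQ -> //|i u k k' _ IH]; congr InOp.
  exact: functional_extensionality.
by elim: t => [a|i u k IH]; constructor=> //; apply/hQ.
Qed.

Lemma bind_rel (X X' Y Y' : Type) (Q : X -> X' -> Prop) (P : Y -> Y' -> Prop)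
    (f : X -> free U V Y) (f' : X' -> free U V Y') t t' :
  (forall a a', Q a a' -> free_rel P (f a) (f' a')) ->
  free_rel Q t t' -> free_rel P (bind f t) (bind f' t').
Proof. by move=> hf; elim=> [a b /hf //|i u k k' _ IH] /=; constructor. Qed.

End FreeRel.

(** * Logical relation between skeletal meanings *)

Lemma skel_eq_dec (S S' : skel) : {S = S'} + {S <> S'}.
Proof. by decide equality; apply: eq_comparable. Qed.

Section SkelRel.
Variables (Sg : signature) (U V : Sg -> Type) (r : nat -> Type).
Local Notation sk := (skel_sem U V r).

(* The skeletons may differ because the two instantiations of a term may
   disagree on parameters that do not occur in its type; at equal skeletons the
   relation is equality. *)
Fixpoint skrel (S S' : skel) : sk S -> sk S' -> Prop :=
  match S, S' return sk S -> sk S' -> Prop with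
  | SArr S1 S2, SArr S1' S2' => fun f f' =>
      forall a a', skrel a a' -> free_rel (@skrel S2 S2') (f a) (f' a')
  | T, T' => fun a a' => existT sk T a = existT sk T' a'
  end.

(** The induction needs an equivalence: at an arrow, one direction turns equal arguments into
    related ones, the other turns related arguments into equal ones. *)
Lemma skrel_eq S (a b : sk S) : skrel a b <-> a = b.
Proof.
elim: S a b => [x|| S1 IH1 S2 IH2] a b /=.
- by split=> [/(inj_pair2_eq_dec _ skel_eq_dec sk)|->].
- by split=> [/(inj_pair2_eq_dec _ skel_eq_dec sk)|->].
- split=> [h|<- c c' /IH1 <-]; last exact/(free_rel_eq IH2).
  by apply: functional_extensionality => c; apply/(free_rel_eq IH2)/h/IH1.
Qed.

Lemma skrel_coe S1 S2 S1' S2' (e : S1 = S1') (e' : S2 = S2') a b :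
  skrel a b -> skrel (coe (f_equal sk e) a) (coe (f_equal sk e') b).
Proof. by case: _ / e; case: _ / e'. Qed.

Lemma free_skrel_coe S1 S2 S1' S2' (e : S1 = S1') (e' : S2 = S2') t u :
  free_rel (@skrel S1 S2) t u ->
  free_rel (@skrel S1' S2') (coe (f_equal (fun S => free U V (sk S)) e) t)
    (coe (f_equal (fun S => free U V (sk S)) e') u).
Proof. by case: _ / e; case: _ / e'. Qed.

End SkelRel.

(** * Coherence: independence of annotations, coercions and derivations *)

Section Coherence.
Variables (Sg : signature) (M : sig_sem Sg) (Xi : ctx Sg).
Variable xi : assignment M Xi.

Fixpoint env_rel (G G' : seq (vty Sg)) :
    env (vsk xi) G -> env (vsk xi) G' -> Prop :=
  match G, G' return env (vsk xi) G -> env (vsk xi) G' -> Prop with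
  | [::], [::] => fun _ _ => True
  | A :: G, A' :: G' => fun e e' => env_rel e.1 e'.1 /\ skrel e.2 e'.2
  | _, _ => fun _ _ => False
  end.

Lemma env_rel_refl G (e : env (vsk xi) G) : env_rel e e.
Proof. by elim: G e => //= A G IH [e a]; split=> //; apply/skrel_eq. Qed.

Lemma env_proj_rel G x A (p : tvar G x A) G' x' A' (p' : tvar G' x' A') e e' :
  x = x' -> env_rel e e' -> skrel (env_proj p e) (env_proj p' e').
Proof.
elim: p G' x' A' p' e e' => {G x A} [G A|G x A B p IH] G' x' A'.
  by case=> // G0 A0 e e' _ /= [].
by case=> // G0 z A0 B0 q e e' [E] /= [h _]; apply: IH E h.
Qed.

(** The two derivations may bind variables at different types; this is harmless because every binder
    is entered with related arguments only. *)
Lemma vsem_rel G v A (d : has_vty Xi G v A) :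
  forall G' v' A' (d' : has_vty Xi G' v' A'), forget_val v = forget_val v' ->
  forall e e', env_rel e e' -> skrel (vsem (xi := xi) d e) (vsem d' e').
Proof.
move: G v A d.
apply: (@has_vty_ind2 Sg Xi
  (fun G v A d => forall G' v' A' (d' : has_vty Xi G' v' A'),
    forget_val v = forget_val v' ->
    forall e e', env_rel e e' -> skrel (vsem (xi := xi) d e) (vsem d' e'))
  (fun G c C d => forall G' c' C' (d' : has_cty Xi G' c' C'),
    forget_cmp c = forget_cmp c' -> forall e e', env_rel e e' ->
    free_rel (@skrel Sg (@argS Sg M) (@resS Sg M) (as_s xi)
                (cskel Xi C) (cskel Xi C'))
      (csem (xi := xi) d e) (csem d' e'))).
- move=> G x A p G' v' A' [] // {}G' x' {}A' p' [E] e e' he.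
  exact: env_proj_rel.
- by move=> G G' v' A' [].
- move=> G A S c C hA dc IH G' v' A' [] // {}G' B S' c' C' hB dc' /= [E].
  by move=> e e' he a a' ha; apply: IH.
- move=> G v g A B d IH h G' v' A' [] // {}G' w g' {}A' B' d' h' /= [E].
  by move=> e e' he; apply: skrel_coe; apply: IH.
- move=> G v A d IH G' c' C' [] // {}G' v' A' d' /= [E] e e' he.
  by constructor; apply: IH.
- move=> G o v c A D d IH dc IHc ho G' c' C' [] //.
  move=> {}G' o' v' {}c' A' D' d' dc' ho' /= [Eo Ev Ec] e e' he; subst o'.
  (* Both arguments have type [argT o], where the relation is equality; the same holds at [resT o]
     for the results passed to the continuations. *)
  have /skrel_eq -> := IH _ _ _ d' Ev e e' he.
  apply: FR_op => b; apply: (IHc _ _ _ dc' Ec); split=> //; exact/skrel_eq.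
- move=> G c1 c2 A B D d1 IH1 d2 IH2 G' c' C' [] //.
  move=> {}G' c1' c2' A' B' D' d1' d2' /= [E1 E2] e e' he.
  apply: bind_rel (IH1 _ _ _ d1' E1 e e' he) => a a' ha.
  by apply: (IH2 _ _ _ d2' E2); split.
- move=> G v1 v2 A C d1 IH1 d2 IH2 G' c' C' [] //.
  move=> {}G' v1' v2' A' {}C' d1' d2' /= [E1 E2] e e' he.
  exact: (IH1 _ _ _ d1' E1 e e' he) (IH2 _ _ _ d2' E2 e e' he).
- move=> G c g C C1 d IH h G' c' C' [] // {}G' c1 g' {}C' C1' d' h' /= [E].
  by move=> e e' he; apply: free_skrel_coe; apply: IH.
Qed.

(** Erasure keeps casts, so the additional cast on the right has to be removed before [vsem_rel]
    applies. *)
Lemma vsem_vcast_eq G v v' g A (d : has_vty Xi G v A)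
    (d' : has_vty Xi G (VCast v' g) A) : forget_val v = forget_val v' ->
  forall e, vsem (xi := xi) d e = vsem d' e.
Proof.
move Ew: (VCast v' g) d' => w d' Ev e; apply/skrel_eq.
case: d' Ew d e => // {}G v1 g1 A1 A2 d1 h1 [E _] d e /=; subst v1.
apply: (skrel_coe (erefl _)); apply: (vsem_rel d d1 Ev); exact: env_rel_refl.
Qed.

End Coherence.

(** * Effectful semantics: injectivity of iota and existence of liftings *)

Lemma Tinc_inj (Sg : signature) (M : sig_sem Sg) (E : {set Sg}) (X Y : Type)
    (f : X -> Y) : injective f -> injective (@Tinc Sg M E X Y f).
Proof.
move=> hf; elim=> [a|o u k IH] [b|o' u' k'] //=; first by case=> /hf ->.
(* Membership in [E] is boolean, so an operation of the restricted signature is determined by its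
   underlying element. *)
move=> h; have Eo : o = o' by apply: val_inj; case: h.
subst o'; case: h => Eu Ek.
rewrite (inj_pair2_eq_dec _ (@eq_comparable Sg) _ _ _ _ Eu); congr InOp.
have {}Ek := inj_pair2_eq_dec _ (@eq_comparable Sg) _ _ _ _ Ek.
apply: functional_extensionality => b; apply: IH.
exact: (f_equal (fun f => f b) Ek).
Qed.

Section Effectful.
Variables (Sg : signature) (M : sig_sem Sg) (Xi : ctx Sg).
Variable xi : assignment M Xi.
Local Notation sk := (skel_sem (@argS Sg M) (@resS Sg M) (as_s xi)).

(** At an arrow, the skeletal component is the image itself, and it determines the effectful
    component because iota is injective at the codomain. *)
Lemma viota_inj A : injective (@viota Sg M Xi xi A).
Proof.
move: A; apply: (@vty_mut Sg
  (fun A => injective (@viota Sg M Xi xi A))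
  (fun C => injective (@ciota Sg M Xi xi C))).
- exact: as_iota_inj.
- by [].
- move=> A _ C IHC [[f f'] hf] [[g g'] hg]; rewrite /viota /= => E; subst g.
  have E' : f' = g'.
    apply: functional_extensionality => a; apply: IHC.
    by rewrite /ciota -[LHS]hf -[RHS]hg.
  by subst g'; congr exist; apply: proof_irrelevance.
- by move=> A IHA D; apply: Tinc_inj.
Qed.

Definition arr_eff A C (f : vsk xi A -> csk xi C) (f' : veff xi A -> ceff xi C)
    (h : forall a, ciota (f' a) = f (viota a)) : veff xi (TArr A C) :=
  exist (fun p : (vsk xi A -> csk xi C) * (veff xi A -> ceff xi C) =>
           forall a, p.1 (viota a) = ciota (p.2 a))
    (f, f') (fun a => esym (h a)).

(** The three equalities are independent proofs, so that any that arise from typing match; [e1] is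
    reversed because domains are contravariant. *)
Lemma coe_arr S1 S2 S1' S2' (e1 : S1' = S1) (e2 : S2 = S2')
    (e : SArr S1 S2 = SArr S1' S2') f x :
  coe (f_equal sk e) f x =
  coe (f_equal (fun S => Tall M (sk S)) e2) (f (coe (f_equal sk e1) x)).
Proof.
by subst; rewrite (UIP_dec skel_eq_dec e (erefl _)).
Qed.

Lemma coe_ret S S' (e : S = S') a :
  coe (f_equal (fun S => Tall M (sk S)) e) (InRet a) =
  InRet (coe (f_equal sk e) a).
Proof. by case: _ / e. Qed.

Lemma coe_op S S' (e : S = S') o u k :
  coe (f_equal (fun S => Tall M (sk S)) e) (InOp o u k) =
  InOp o u (fun b => coe (f_equal (fun S => Tall M (sk S)) e) (k b)).
Proof. by case: _ / e. Qed.

Lemma dirt_eff_sub g D D' :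
  dco_ty Xi g D D' -> dirt_eff xi D \subset dirt_eff xi D'.
Proof.
elim=> {g D D'} //=.
- by move=> w D D' h; apply: as_dc h.
- by move=> g2 g1 X Y Z _ h1 _ h2; apply: subset_trans h1 h2.
- by move=> d _; rewrite /dirt_eff /= setU0 sub0set.
- by move=> o g D D' _ h; rewrite /dirt_eff /= -!setUA setUS.
- move=> o g D D' _ h; rewrite /dirt_eff /= -!setUA.
  exact: subset_trans h (subsetUr _ _).
Qed.

(** What casts require of coercions: transport along the skeleton preserves the image of iota. The
    equality [e] is arbitrary, so that the induction singles out no proof of it. *)
Lemma co_lift :
  (forall g A A', vco_ty Xi g A A' -> forall (e : vskel Xi A = vskel Xi A')
     (x : veff xi A), exists y : veff xi A', viota y = vsk_coe e (viota x)) /\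
  (forall g C C', cco_ty Xi g C C' -> forall (e : cskel Xi C = cskel Xi C')
     (x : ceff xi C), exists y : ceff xi C', ciota y = csk_coe e (ciota x)).
Proof.
apply: (@vco_cco_ty_ind Sg Xi
  (fun g A A' _ => forall (e : vskel Xi A = vskel Xi A') (x : veff xi A),
    exists y : veff xi A', viota y = vsk_coe e (viota x))
  (fun g C C' _ => forall (e : cskel Xi C = cskel Xi C') (x : ceff xi C),
    exists y : ceff xi C', ciota y = csk_coe e (ciota x))).
- move=> w X X' h e x; exists (as_vc h x); rewrite as_vc_iota.
  by rewrite (UIP_dec skel_eq_dec e (DVco_skel h)).
- move=> g2 g1 X Y Z h1 IH1 h2 IH2 e x.
  have [y Ey] := IH1 (vco_ty_skel h1) x.
  have [z Ez] := IH2 (vco_ty_skel h2) y; exists z; rewrite Ez Ey /vsk_coe.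
  move: (vco_ty_skel h1) (vco_ty_skel h2) (viota x) e; rewrite /vsk.
  move: (vskel Xi X) (vskel Xi Y) (vskel Xi Z) => SX SY SZ e1 e2 t e.
  by subst SY SZ; rewrite (UIP_dec skel_eq_dec e (erefl _)).
- by move=> a S _ e x; exists x; rewrite (UIP_dec skel_eq_dec e (erefl _)).
- by move=> e x; exists x; rewrite (UIP_dec skel_eq_dec e (erefl _)).
- move=> gv gc X X' C C' hv IHv hc IHc e [[f f'] hf].
  have e1 := vco_ty_skel hv; have e2 := cco_ty_skel hc.
  (* The new effectful component is [f'] between a lift along [gv] and a lift along [gc], found
     pointwise and assembled by choice. *)
  have H (a : veff xi X') : exists b : ceff xi C',
      ciota b = vsk_coe e f (viota a).
    have [a1 Ea1] := IHv e1 a; have [b Eb] := IHc e2 (f' a1).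
    exists b; rewrite Eb /vsk_coe (coe_arr e1 e2) /csk_coe /ciota.
    by congr coe; rewrite -[LHS]hf; congr f.
  have [h hh] := functional_choice _ H.
  by exists (arr_eff hh).
- move=> gv gd X X' D D' hv IHv hd e t.
  have sDD := dirt_eff_sub hd.
  elim: t => [a|o u k IH].
    have [b Eb] := IHv e a; exists (InRet b).
    by rewrite /csk_coe [RHS]coe_ret; congr InRet.
  have [k' hk'] := functional_choice _ IH.
  exists (@InOp _ _ _ _ (exist _ (val o) (subsetP sDD _ (valP o))) u k').
  rewrite /csk_coe [RHS]coe_op; congr InOp.
  by apply: functional_extensionality => b; apply: hk'.
Qed.

(* The reason why result types of operations must not be arrows: a
   continuation has to accept every skeletal result. *)
Lemma viota_ground_surj A : vty_closed A -> (forall B C, A <> TArr B C) ->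
  forall x : vsk xi A, exists y, viota y = x.
Proof. by case: A => [a||B C] // _ h x; [exists x | case: (h B C)]. Qed.

Lemma env_proj_map G x A (p : tvar G x A) (a : env (veff xi) G) :
  env_proj p (env_map (@viota _ _ _ xi) a) = viota (env_proj p a).
Proof. by elim: p a => //= *. Qed.

Lemma vsem_lift G v A (d : has_vty Xi G v A) (a : env (veff xi) G) :
  exists y, viota y = vsem d (env_map (@viota _ _ _ xi) a).
Proof.
move: G v A d a.
apply: (@has_vty_ind2 Sg Xi
  (fun G v A d => forall a, exists y : veff xi A,
    viota y = vsem d (env_map (@viota _ _ _ xi) a))
  (fun G c C d => forall a, exists y : ceff xi C,
    ciota y = csem d (env_map (@viota _ _ _ xi) a))).
- by move=> G x A p a; exists (env_proj p a); rewrite /= env_proj_map.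
- by move=> G a; exists tt.
- move=> G A S c C hA d IH a.
  have [f' hf'] := functional_choice _ (fun a' : veff xi A => IH (a, a')).
  by exists (arr_eff
    (f := vsem (T_fun hA d) (env_map (@viota _ _ _ xi) a)) hf').
- move=> G v g A A' d IH h a; have [y Ey] := IH a.
  by have [z Ez] := co_lift.1 _ _ _ h (vco_ty_skel h) y; exists z; rewrite Ez Ey.
- by move=> G v A d IH a; have [y Ey] := IH a; exists (InRet y); congr InRet.
- move=> G o v c A D d IH dc IHc ho a.
  have H b : exists t : ceff xi (TComp A D),
      ciota t = csem dc (env_map (@viota _ _ _ xi) a, op_res xi b).
    (* The induction hypothesis covers effectful arguments, so the skeletal result is first written
       as an image under iota. *)
    have [y <-] := viota_ground_surj (@resT_closed Sg o) (@resT_not_arr Sg o)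
                     (op_res xi b).
    exact: (IHc (a, y)).
  have [k hk] := functional_choice _ H.
  have ho' : o \in dirt_eff xi D by rewrite inE ho.
  exists (@InOp _ _ _ _ (exist _ o ho')
            (op_arg (vsem d (env_map (@viota _ _ _ xi) a))) k).
  by congr InOp; apply: functional_extensionality.
- move=> G c1 c2 A A' D d1 IH1 d2 IH2 a /=; have [t <-] := IH1 a.
  (* Induction on the tree of [c1], with [c2] taking over at its leaves. *)
  elim: t => [x|o u k IH]; first exact: (IH2 (a, x)).
  have [k' hk'] := functional_choice _ IH; exists (@InOp _ _ _ _ o u k').
  by congr InOp; apply: functional_extensionality.
- move=> G v1 v2 A C d1 IH1 d2 IH2 a /=.
  have [p <-] := IH1 a; have [x <-] := IH2 a.
  by case: p => [[f f'] hf]; exists (f' x); rewrite -[LHS]hf.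
- move=> G c g C C' d IH h a; have [y Ey] := IH a.
  by have [z Ez] := co_lift.2 _ _ _ h (cco_ty_skel h) y; exists z; rewrite Ez Ey.
Qed.

(** One map, chosen for [v], serves both terms; uniqueness comes from injectivity of iota. *)
Lemma same_veff_semI G v v' A : has_vty Xi G v A -> has_vty Xi G v' A ->
  (forall (d : has_vty Xi G v A) (d' : has_vty Xi G v' A) a,
     vsem (xi := xi) d a = vsem d' a) ->
  same_veff_sem xi G v v' A.
Proof.
move=> d d' h; have [f hf] := functional_choice _ (vsem_lift d).
exists f; split; split.
- by exists d.
- move=> f' [d1 hd1]; apply: functional_extensionality => a; apply: viota_inj.
  (* [d1] is a second derivation for [v]; it is compared with [d] through [d']. *)
  by rewrite hf hd1 (h d d') -(h d1 d').
- by exists d' => a; rewrite hf.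
- move=> f' [d1 hd1]; apply: functional_extensionality => a; apply: viota_inj.
  by rewrite hf hd1.
Qed.

End Effectful.

Theorem corollary6p4 (Sg : signature) (M : sig_sem Sg)
    (Xuse : ctx Sg) (Phi : phase Sg) (Phi_complete : complete Xuse Phi)
    (Xi : ctx Sg) (v : value Sg) (A : vty Sg)
    (v_typed : has_vty Xi [::] v A)
    (Xi' : ctx Sg) (s : subst Sg)
    (Phi_run : Phi Xi (fp_vty A) = Some (Xi', s))
    (eta : subst Sg) (eta_valid : valid_subst eta Xi Xuse) :
  exists (eta' : subst Sg) (g : vco Sg),
    valid_subst eta' Xi' Xuse /\
    vco_ty Xuse g (vty_sub eta' (vty_sub s A)) (vty_sub eta A) /\
    forall xi : assignment M Xuse,
      same_veff_sem xi [::] (val_sub eta v)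
        (VCast (val_sub eta' (val_sub s v)) g) (vty_sub eta A).
Proof.
have [eta' [Y [eta'_valid hY]]] := Phi_complete _ _ _ _ Phi_run _ eta_valid.
have [|S hA] := has_vty_skel _ v_typed.
  by move=> x B p; inversion p.
(* The family starts at the composite of [eta'] and [s]; the composition law brings the coercion to
   the required source. *)
have [g hg] := fam_vty hA hY; rewrite vty_sub_comp in hg.
exists eta', g; do 2!split=> //; move=> xi; apply: same_veff_semI.
- exact: (has_vty_sub eta_valid v_typed).
- apply: T_vcast hg.
  exact: (has_vty_sub eta'_valid (has_vty_sub (run_valid Phi_run) v_typed)).
- by move=> d d' a; apply: vsem_vcast_eq; rewrite !forget_val_sub.
Qed.
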